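(* As $n\to\infty$, $$\log_2\frac{Z_\cap(n)}{R(n)}\;=\;2^{\,n-1}-2+\log_2\tfrac43+o(1).$$
   Context: $[n]=\{1,\dots,n\}$; $V_n$ is the set of nonempty subsets of $[n]$. A family $\mathcal F\subseteq V_n$ is intersecting if $A\cap B\ne\varnothing$ for all $A,B\in\mathcal F$ (the empty family is intersecting). Its kernel is $\ker\mathcal F=\bigcap_{S\in\mathcal F}S$, with $\ker\varnothing=[n]$. The weight is $w(S)=2^{2^{n-|S|}}-1$ for $S\in V_n$. $Z_\cap(n)=\sum_{\mathcal F}\prod_{S\in\mathcal F}w(S)$ over all intersecting families $\mathcal F\subseteq V_n$ with $\ker\mathcal F\ne\varnothing$ (empty product $=1$), and $R(n)$ is the same sum over all intersecting families with $\ker\mathcal F=\varnothing$. *)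

(* Defs.v *)
From HB Require Import structures.
From mathcomp Require Import all_boot all_order all_algebra.
From mathcomp Require Import all_classical all_reals all_analysis.

Set Implicit Arguments.
Unset Strict Implicit.
Unset Printing Implicit Defensive.

Import Order.TTheory GRing.Theory Num.Theory.
Import numFieldNormedType.Exports.

Definition nonempty_sets (n : nat) : {set {set 'I_n}} := [set S | S != finset.set0].

Definition intersecting (n : nat) (F : {set {set 'I_n}}) : bool :=
  [forall A in F, forall B in F, (A :&: B)%SET != finset.set0].

(* The intersection is taken in the lattice of subsets of 'I_n, so the kernel
   of the empty family is the whole of 'I_n. *)
Definition kernel (n : nat) (F : {set {set 'I_n}}) : {set 'I_n} :=
  (\bigcap_(S in F) S)%SET.

Definition weight (n : nat) (S : {set 'I_n}) : nat := (2 ^ (2 ^ (n - #|S|)) - 1)%N.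

Definition Zcap (n : nat) : nat :=
  (\sum_(F : {set {set 'I_n}} | [&& F \subset nonempty_sets n, intersecting F
                                  & kernel F != finset.set0])
     \prod_(S in F) weight S)%N.

Definition Rcap (n : nat) : nat :=
  (\sum_(F : {set {set 'I_n}} | [&& F \subset nonempty_sets n, intersecting F
                                  & kernel F == finset.set0])
     \prod_(S in F) weight S)%N.

Definition log2 (R : realType) (x : R) : R := (ln x / ln 2)%R.

(* Main.v *)
(* The weight [w S = 2^(2^(n-|S|)) - 1] makes [1 + w S] a power of two, so the total weight of the
   subfamilies of the star of [i] is exactly [Q = 2^(3^(n-1))] and [Zcap n ~ n Q].  The main
   families with empty kernel miss [i] only through the set [~{i}], of weight 3, at the cost of the
   single set [{i}], for which [1 + w {i} = H = 2^(2^(n-1))]; hence [Rcap n ~ 3 n Q / H].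

   For the upper bound on [Rcap n], call a family near the star of [i] if all its members avoiding
   [i] have more than [n/2] elements.  Each such member [A] forbids its complement, which changes
   the weight by a factor [w A / (1 + w (~A))]; this is doubly exponentially small for
   [A <> ~{i}].  A family far from all stars generates an up-set whose 1/3-biased measure is at most
   [1/3 - 2 (2/3)^n], and this gain beats the number [2^(2^n)] of all families.  Indeed, let [x] be
   the 2/3-biased measure of the section [M0] of the up-set where [i] is absent.  Then the sections
   have 1/3-biased measures [mu1 <= 1 - x] (cross-intersection) and [mu0 <= x^2/4 + 3x^3/4]
   (isoperimetry), so [x] times the influence of [i] is bounded by the defect [1/3 - mu].  Since
   [x >= (2/3)^(n/2)], a tiny defect would make all influences tiny, against Poincare. *)
Require Import Defs.
From HB Require Import structures.
From mathcomp Require Import all_boot all_order all_algebra.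
From mathcomp Require Import ring lra zify.

Set Implicit Arguments.
Unset Strict Implicit.
Unset Printing Implicit Defensive.

Import Order.TTheory GRing.Theory Num.Theory.

Local Open Scope ring_scope.

(** * Biased product measures on subsets of a finite type *)

(* Expectation of [f] at the set obtained from [S] by resampling the elements listed in [l], each
   being present with probability [p].  Recursion on [l] allows tensorization arguments over a fixed
   ground set. *)
Fixpoint mean (R : realFieldType) (T : finType) (p : R) (l : seq T)
    (f : {set T} -> R) (S : {set T}) : R :=
  if l is i :: l' then p * mean p l' f (i |: S) + (1 - p) * mean p l' f (S :\ i)
  else f S.

Lemma meanB (R : realFieldType) (T : finType) (p : R) (l : seq T)
    (f g : {set T} -> R) S :
  mean p l (fun U => f U - g U) S = mean p l f S - mean p l g S.
Proof. by elim: l S => [|i l IH] S //=; rewrite !IH; ring. Qed.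

Lemma mean_cst (R : realFieldType) (T : finType) (p c : R) (l : seq T) (S : {set T}) :
  mean p l (fun=> c) S = c.
Proof. by elim: l S => [|i l IH] S //=; rewrite !IH; ring. Qed.

Lemma mean_le (R : realFieldType) (T : finType) (p : R) (l : seq T)
    (f g : {set T} -> R) S : 0 <= p <= 1 -> (forall U, f U <= g U) ->
  mean p l f S <= mean p l g S.
Proof.
move=> p01 fg; elim: l S => [|i l IH] S //=.
by rewrite lerD// ler_wpM2l//; lra.
Qed.

Definition monotone (R : realFieldType) (T : finType) (f : {set T} -> R) :=
  forall S U : {set T}, S \subset U -> f S <= f U.

Lemma mean_monotone (R : realFieldType) (T : finType) (p : R) (l : seq T)
    (f : {set T} -> R) : 0 <= p <= 1 -> monotone f -> monotone (mean p l f).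
Proof.
move=> p01 fm; elim: l => [|i l IH] S U SU //=; first exact: fm.
rewrite lerD// ler_wpM2l// ?IH// ?setUS ?setSD//; lra.
Qed.

Lemma mean_setC (R : realFieldType) (T : finType) (p : R) (l : seq T)
    (f : {set T} -> R) S :
  mean p l (fun U => f (~: U)) S = mean (1 - p) l f (~: S).
Proof.
elim: l S => [|i l IH] S //=.
have -> : i |: ~: S = ~: (S :\ i) by rewrite setDE setCI setCK setUC.
have -> : (~: S) :\ i = ~: (i |: S) by rewrite setCU setDE setIC.
by rewrite !IH; ring.
Qed.

Lemma mean_setU1 (R : realFieldType) (T : finType) (p : R) (l : seq T)
    (f : {set T} -> R) (i : T) S : i \notin l ->
  mean p l (fun U => f (i |: U)) S = mean p l f (i |: S).
Proof.
elim: l S => [|j l IH] S //=; rewrite inE negb_or => /andP[ij il].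
rewrite !IH// setUCA; congr (_ + _ * mean _ _ _ _).
by apply/setP => x; rewrite !inE; case: (x =P i) => [->|]; rewrite ?ij.
Qed.

Lemma mean_setD1 (R : realFieldType) (T : finType) (p : R) (l : seq T)
    (f : {set T} -> R) (i : T) S : i \notin l ->
  mean p l (fun U => f (U :\ i)) S = mean p l f (S :\ i).
Proof.
elim: l S => [|j l IH] S //=; rewrite inE negb_or => /andP[ij il].
rewrite !IH//.
have -> : (j |: S) :\ i = j |: (S :\ i).
  by apply/setP => x; rewrite !inE; case: (x =P j) => [->|]; rewrite ?andbT // eq_sym ij.
by have -> : (S :\ j) :\ i = (S :\ i) :\ j by apply/setP => x; rewrite !inE andbCA.
Qed.

(** Elements are resampled independently, so [i] can be decided first. The sections stay functions
    on the whole cube, which keeps [l] unchanged. *)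
Lemma mean_section (R : realFieldType) (T : finType) (p : R) (l : seq T)
    (f : {set T} -> R) (i : T) S : uniq l -> i \in l ->
  mean p l f S = p * mean p l (fun U => f (i |: U)) S
                 + (1 - p) * mean p l (fun U => f (U :\ i)) S.
Proof.
elim: l S => [|j l IH] S //= /andP[jl ul]; rewrite inE => /predU1P[->|il].
  rewrite !mean_setU1// !mean_setD1//.
  have -> : j |: (j |: S) = j |: S by rewrite setUA setUid.
  have -> : j |: (S :\ j) = j |: S by apply/setP => x; rewrite !inE; case: eqP.
  have -> : (j |: S) :\ j = S :\ j by apply/setP => x; rewrite !inE; case: eqP.
  have -> : (S :\ j) :\ j = S :\ j by apply/setP => x; rewrite !inE; case: eqP.
  by ring.
by rewrite !(IH _ ul il); ring.
Qed.

(** * Isoperimetry and Poincare inequality for monotone 0-1 functions *)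

(* The cubic interpolates the pairs (2/3-biased, 1/3-biased measure) of the empty family, of a star
   and of the full family: its values at 0, 2/3, 1 are 0, 1/3, 1. *)
Lemma mean_third_le (R : realFieldType) (T : finType) (l : seq T)
    (f : {set T} -> R) S :
  monotone f -> (forall U, f U = 0 \/ f U = 1) ->
  mean (1 / 3) l f S <= mean (2 / 3) l f S ^+ 2 / 4 + 3 * mean (2 / 3) l f S ^+ 3 / 4.
Proof.
move=> fm f01; elim: l S => [|i l IH] S /=.
  by case: (f01 S) => ->; lra.
have h (a b u v x : R) : x = 2 / 3 * b + (1 - 2 / 3) * a -> 0 <= a -> a <= b -> b <= 1 ->
    u <= a ^+ 2 / 4 + 3 * a ^+ 3 / 4 -> v <= b ^+ 2 / 4 + 3 * b ^+ 3 / 4 ->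
    1 / 3 * v + (1 - 1 / 3) * u <= x ^+ 2 / 4 + 3 * x ^+ 3 / 4.
  move=> xE a0 ab b1 hu hv.
  (* This is the cubic at x minus the average of its values at b and a with weights 1/3 and 2/3. Its
     only negative term, -b^2, is absorbed by b. *)
  have key : 0 <= (b - a) * (5 * a + b + 17 * a ^+ 2 + 11 * a * b - b ^+ 2) / 36.
    rewrite divr_ge0// mulr_ge0 ?subr_ge0//.
    have : 0 <= a * b by rewrite mulr_ge0// (le_trans a0).
    have : 0 <= a ^+ 2 by rewrite sqr_ge0.
    have : 0 <= b * (1 - b) by rewrite mulr_ge0 ?subr_ge0// (le_trans a0).
    lra.
  have -> : x ^+ 2 / 4 + 3 * x ^+ 3 / 4 =
    1 / 3 * (b ^+ 2 / 4 + 3 * b ^+ 3 / 4) + (1 - 1 / 3) * (a ^+ 2 / 4 + 3 * a ^+ 3 / 4)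
     + (b - a) * (5 * a + b + 17 * a ^+ 2 + 11 * a * b - b ^+ 2) / 36.
    by rewrite xE; field.
  lra.
have p01 : 0 <= (2 / 3 : R) <= 1 by lra.
apply: (h _ _ _ _ _ erefl _ _ _ (IH _) (IH _)).
- by rewrite -(mean_cst (2 / 3) 0 l (S :\ i)) mean_le// => U; case: (f01 U) => ->; lra.
- by apply: mean_monotone => //; exact: subset_trans (subD1set _ _) (subsetUr _ _).
- by rewrite -[leRHS](mean_cst (2 / 3) 1 l (i |: S)) mean_le// => U; case: (f01 U) => ->; lra.
Qed.

(** If every resampling of an element of [A] puts it in, the sample contains [A] and monotonicity
    makes [f] at least 1. *)
Lemma mean_ge_pow (R : realFieldType) (T : finType) (p : R) (l : seq T)
    (f : {set T} -> R) (A S : {set T}) :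
  0 <= p <= 1 -> monotone f -> 0 <= f set0 -> f A = 1 ->
  A \subset S :|: [set x in l] -> p ^+ count (mem A) l <= mean p l f S.
Proof.
move=> /andP[p0 p1] fm f0 fA; elim: l S => [|i l IH] S /= AS.
  by rewrite expr0 -fA fm//; apply: subset_trans AS _; apply/subsetP => x; rewrite !inE orbF.
have ge0 U : 0 <= mean p l f U.
  by rewrite -[leLHS](mean_cst p 0 l U) mean_le ?p0// => V; rewrite (le_trans f0)// fm// sub0set.
have hU : p ^+ count (mem A) l <= mean p l f (i |: S).
  by apply: IH; apply: subset_trans AS _; apply/subsetP => x; rewrite !inE orbCA orbA.
case: (boolP (i \in A)) => iA.
  rewrite exprS; apply: ler_wpDr; first by rewrite mulr_ge0 ?subr_ge0.
  by rewrite ler_wpM2l.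
have hD : p ^+ count (mem A) l <= mean p l f (S :\ i).
  apply: IH; apply/subsetP => x xA; move/subsetP/(_ _ xA): AS; rewrite !inE.
  by have -> : x == i = false by apply: contraNF iA => /eqP <-.
rewrite add0n; have -> :
    p ^+ count (mem A) l = p * p ^+ count (mem A) l + (1 - p) * p ^+ count (mem A) l by ring.
by rewrite lerD// ler_wpM2l ?subr_ge0.
Qed.

(** The left side is the variance of the 0-1 function [f], and by monotonicity the differences on
    the right are 0-1 valued. Variance tensorizes one element at a time. *)
Lemma mean_poincare (R : realFieldType) (T : finType) (p : R) (l : seq T)
    (f : {set T} -> R) S : 0 <= p <= 1 -> uniq l ->
  monotone f -> (forall U, f U = 0 \/ f U = 1) ->
  mean p l f S - mean p l f S ^+ 2
    <= p * (1 - p) * \sum_(i <- l) mean p l (fun U => f (i |: U) - f (U :\ i)) S.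
Proof.
move=> p01 + fm f01; elim: l S => [|i l IH] S /=.
  by case: (f01 S) => ->; rewrite big_nil; lra.
move=> /andP[il ul]; rewrite big_cons big_split /= -!mulr_sumr.
have := IH (i |: S) ul; have := IH (S :\ i) ul.
rewrite !meanB !mean_setU1// !mean_setD1//.
have -> : i |: (i |: S) = i |: S by rewrite setUA setUid.
have -> : i |: (S :\ i) = i |: S by apply/setP => x; rewrite !inE; case: eqP.
have -> : (i |: S) :\ i = S :\ i by apply/setP => x; rewrite !inE; case: eqP.
have -> : (S :\ i) :\ i = S :\ i by apply/setP => x; rewrite !inE; case: eqP.
set a := mean _ _ _ (i |: S); set b := mean _ _ _ (S :\ i).
set s := \sum_(j <- l) _; set t := \sum_(j <- l) _ => hb ha.
have ba : b <= a.
  by apply: mean_monotone => //; exact: subset_trans (subD1set _ _) (subsetUr _ _).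
have b0 : 0 <= b.
  by rewrite /b -[leLHS](mean_cst p 0 l (S :\ i)) mean_le// => U; case: (f01 U) => ->; lra.
have a1 : a <= 1.
  by rewrite /a -[leRHS](mean_cst p 1 l (i |: S)) mean_le// => U; case: (f01 U) => ->; lra.
case/andP: p01 => p0 p1; have q0 : 0 <= 1 - p by rewrite subr_ge0.
have h1 : 0 <= p * (p * (1 - p) * t - (a - a ^+ 2)) by rewrite mulr_ge0// subr_ge0.
have h2 : 0 <= (1 - p) * (p * (1 - p) * s - (b - b ^+ 2)) by rewrite mulr_ge0// subr_ge0.
(* The conditional mean given [i] has variance p(1-p)(a-b)^2, and 0 <= a-b <= 1 bounds the square by
   a-b. *)
have h3 : 0 <= p * (1 - p) * ((a - b) * (1 - (a - b))).
  by rewrite !mulr_ge0//; lra.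
by lra.
Qed.

(** * Means as weighted sums *)

Lemma mean_sum (R : realFieldType) (T : finType) (p : R) (l : seq T)
    (f : {set T} -> R) S : uniq l ->
  mean p l f S = \sum_(B : {set T} | B :\: [set x in l] == S :\: [set x in l])
                   (\prod_(i <- l) (if i \in B then p else 1 - p)) * f B.
Proof.
elim: l S => [|i l IH] S /=.
  rewrite (big_pred1 S) ?big_nil ?mul1r// => B.
  have -> : [set x in Nil T] = set0 by apply/setP => x; rewrite !inE.
  by rewrite !setD0.
move=> /andP[il ul]; rewrite !IH// [RHS](bigID (fun B : {set T} => i \in B)) /=.
(* For sets agreeing at [i], agreement off [l] and off [i :: l] are the same; this splits the sum by
   whether [B] contains [i]. *)
have hcase (B V : {set T}) : (i \in B) = (i \in V) ->
    (B :\: [set x in l] == V :\: [set x in l]) =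
    (B :\: [set x in i :: l] == V :\: [set x in i :: l]).
  move=> iBV; apply/eqP/eqP => /setP h; apply/setP => x; move: (h x); rewrite !inE.
    by case: (x =P i) => //= _ ->.
  by case: (x =P i) => [->|] //=; rewrite il /= iBV.
congr (_ + _); rewrite mulr_sumr; apply: eq_big => B.
- apply/idP/andP => [h|[h iB]].
    have iB : i \in B.
      by move/eqP/setP/(_ i): h; rewrite !inE (negbTE il) eqxx.
    split=> //; rewrite hcase ?inE ?eqxx// in h.
    rewrite (eqP h); apply/eqP/setP => x; rewrite !inE.
    by case: (x =P i).
  rewrite hcase ?iB ?inE ?eqxx//; rewrite (eqP h); apply/eqP/setP => x; rewrite !inE.
  by case: (x =P i).
- by move=> h; rewrite big_cons mulrA; have -> : i \in B by
    move/eqP/setP/(_ i): h; rewrite !inE (negbTE il) eqxx.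
- apply/idP/andP => [h|[h iB]].
    have iB : i \notin B.
      by move/eqP/setP/(_ i): h; rewrite !inE (negbTE il) eqxx /= => ->.
    split=> //; rewrite hcase ?inE ?eqxx ?(negbTE iB)// in h.
    rewrite (eqP h); apply/eqP/setP => x; rewrite !inE.
    by case: (x =P i).
  rewrite hcase ?(negbTE iB) ?inE ?eqxx//; rewrite (eqP h); apply/eqP/setP => x; rewrite !inE.
  by case: (x =P i).
- move=> h; rewrite big_cons mulrA; have -> : i \in B = false by
    move/eqP/setP/(_ i): h; rewrite !inE (negbTE il) eqxx.
  by [].
Qed.

Lemma mean_enum (R : realFieldType) (T : finType) (p : R) (f : {set T} -> R) S U :
  mean p (enum T) f S = mean p (enum T) f U.
Proof.
rewrite !mean_sum ?enum_uniq//; apply: eq_bigl => B.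
have -> : [set x in enum T] = setT by apply/setP => x; rewrite !inE mem_enum.
by rewrite !setDT.
Qed.

(** The reason for the bias 1/3: [S] has probability 2^(n-|S|)/3^n, whose numerator is the binary
    logarithm of [1 + weight S]. *)
Lemma mean_enum_third (R : realFieldType) (n : nat) (f : {set 'I_n} -> R) :
  3 ^+ n * mean (1 / 3) (enum 'I_n) f set0 = \sum_(S : {set 'I_n}) 2 ^+ (n - #|S|) * f S.
Proof.
rewrite mean_sum ?enum_uniq// mulr_sumr; apply: eq_big => [B|B _].
  have -> : [set x in enum 'I_n] = setT by apply/setP => x; rewrite !inE mem_enum.
  by rewrite !setDT eqxx.
rewrite mulrA; congr (_ * _).
have -> : 3 ^+ n = \prod_(i <- enum 'I_n) 3 :> R by rewrite big_enum prodr_const card_ord.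
rewrite -big_split big_enum /= (eq_bigr (fun i => if i \in ~: B then 2 else 1)).
  by rewrite -big_mkcond prodr_const cardsCs setCK card_ord.
by move=> i _; rewrite inE; case: ifP => _ /=; field.
Qed.

(** * Measure of intersecting families far from all stars *)

Definition zero_one (R : realFieldType) (T : finType) (f : {set T} -> R) :=
  forall S, f S = 0 \/ f S = 1.

(** For a 0-1 valued [f] this is the intersecting property, in an additive form that can be
    averaged. *)
Definition sum_disjoint_le1 (R : realFieldType) (T : finType) (f : {set T} -> R) :=
  forall S U : {set T}, [disjoint S & U] -> f S + f U <= 1.

(** Let m1, m0 be the 1/3-biased means of the sections with and without [i]. Then mu = m1/3 + 2 m0/3
    and I = m1 - m0 = 3/2 (m1 - mu), where m1 <= 1 - x and m0 is bounded by the cubic in x. *)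
Lemma influence_le (R : realFieldType) (T : finType) (f : {set T} -> R) (i : T) :
  monotone f -> zero_one f -> sum_disjoint_le1 f ->
  let mu := mean (1 / 3) (enum T) f set0 in
  let I := mean (1 / 3) (enum T) (fun U => f (i |: U) - f (U :\ i)) set0 in
  let x := mean (2 / 3) (enum T) (fun U => f (U :\ i)) set0 in
  mu <= 1 / 3 /\ x * I <= 9 / 2 * (1 / 3 - mu).
Proof.
move=> fm f01 fc /=; set f0 := fun U => f (U :\ i); set f1 := fun U => f (i |: U).
have p01 : 0 <= (1 / 3 : R) <= 1 by lra.
have q01 : 0 <= (2 / 3 : R) <= 1 by lra.
have fm0 : monotone f0 by move=> S U SU; apply: fm; exact: setSD.
have f010 : zero_one f0 by move=> S; exact: f01.
have := @mean_section _ _ (1 / 3) (enum T) f i set0 (enum_uniq _) (mem_enum _ _).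
rewrite meanB -/f0 -/f1.
have := @mean_third_le _ _ (enum T) f0 set0 fm0 f010.
(* Cross-intersection: [i |: U] and [(~: U) :\ i] are disjoint, and complementation exchanges the
   biases 1/3 and 2/3. *)
have : mean (1 / 3) (enum T) f1 set0 <= 1 - mean (2 / 3) (enum T) f0 set0.
  have -> : 2 / 3 = 1 - 1 / 3 :> R by field.
  rewrite (mean_enum _ f0 _ (~: set0)) -mean_setC.
  rewrite -[X in _ <= X - _](mean_cst (1 / 3) 1 (enum T) set0) -meanB.
  apply: mean_le => // U; rewrite lerBrDr; apply: fc.
  by rewrite disjoints_subset; apply/subsetP => x; rewrite !inE => /orP[->//|->]; rewrite andbF.
have : mean (1 / 3) (enum T) f0 set0 <= mean (1 / 3) (enum T) f1 set0.
  by apply: mean_le => // U; apply: fm; exact: subset_trans (subD1set _ _) (subsetUr _ _).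
have : 0 <= mean (2 / 3) (enum T) f0 set0.
  by rewrite -[leLHS](mean_cst (2 / 3) 0 (enum T) set0) mean_le// => U; case: (f010 U) => ->; lra.
have : mean (2 / 3) (enum T) f0 set0 <= 1.
  by rewrite -[leRHS](mean_cst (2 / 3) 1 (enum T) set0) mean_le// => U; case: (f010 U) => ->; lra.
move: (mean (2 / 3) _ _ _) (mean (1 / 3) _ f0 _) (mean (1 / 3) _ f1 _) (mean (1 / 3) _ f _).
move=> x m0 m1 mu x1 x0 m01 hm1 hm0 muE.
(* For x <= 2/3, x(1 - 3x/2) is at most 3 times the defect 1/3 - mu, and I <= 1 - 3x/2 + 3/2 (1/3 -
   mu) brings the constant to 9/2. For x > 2/3, already m1 < 1/3. *)
have [hx|hx] := leP x (2 / 3).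
  have h : x * (1 + x) * (1 - 3 / 2 * x) <= 3 * (1 / 3 - mu) by lra.
  have h0 : 0 <= x * (1 - 3 / 2 * x) by rewrite mulr_ge0//; lra.
  have h1 : 0 <= x * (x * (1 - 3 / 2 * x)) by rewrite mulr_ge0.
  have loss : 0 <= 1 / 3 - mu by lra.
  have h2 : x * (m1 - m0) <= x * (1 - 3 / 2 * x + 3 / 2 * (1 / 3 - mu)) by rewrite ler_wpM2l//; lra.
  have h3 : x * (1 / 3 - mu) <= 1 * (1 / 3 - mu) by rewrite ler_wpM2r.
  by split; lra.
have loss : 0 <= 1 / 3 - mu by lra.
have h2 : x * (m1 - m0) <= 1 * (m1 - m0) by rewrite ler_wpM2r// subr_ge0.
by split; lra.
Qed.

(** The numerical end of the next lemma, where k = n/2 turns 15 into the threshold 30 <= n. *)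
Lemma expr_two_third_le (R : realFieldType) (k : nat) : (15 <= k)%N ->
  (6 * k%:R + 5) * (2 / 3) ^+ k <= 1 / 3 :> R.
Proof.
move=> /subnKC <-; elim: (k - 15)%N => [|j IH].
  by rewrite addn0 !exprS expr0; lra.
rewrite addnS exprS -natr1; apply: le_trans IH.
rewrite mulrA ler_wpM2r// ?exprn_ge0//; first lra.
have : 15 <= (15 + j)%:R :> R by rewrite ler_nat leq_addr.
lra.
Qed.

(** Let t = (2/3)^k with k = n/2 rounded down. The small set avoiding [i] gives x >= t, so a defect
    below 2(2/3)^n <= 2 t^2 makes every influence at most 9 t. The sum of n such influences
    contradicts Poincare, as mu is close to 1/3. *)
Lemma intersecting_measure_le (R : realFieldType) (n : nat) (f : {set 'I_n} -> R) :
  (30 <= n)%N -> monotone f -> zero_one f -> sum_disjoint_le1 f ->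
  (forall i, exists A : {set 'I_n}, [/\ f A = 1, i \notin A & (2 * #|A| <= n)%N]) ->
  mean (1 / 3) (enum 'I_n) f set0 <= 1 / 3 - 2 * (2 / 3) ^+ n.
Proof.
move=> n30 fm f01 fc far; rewrite leNgt; apply/negP => loss.
set mu := mean _ _ _ _ in loss; set k := n./2.
have k15 : (15 <= k)%N by rewrite /k; lia.
pose t : R := (2 / 3) ^+ k.
have t0 : 0 < t by rewrite exprn_gt0//; lra.
have t1 : t <= 1 by rewrite exprn_ile1//; lra.
have tn : (2 / 3) ^+ n <= t * t :> R.
  by rewrite -exprD ler_wiXn2l//; [lra|lra|rewrite /k; lia].
have muI i := @influence_le _ _ f i fm f01 fc.
(* 9 = 9/2 * 2: x I <= 9/2 (1/3 - mu) < 9 t^2, while x >= t. *)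
have Ile i : mean (1 / 3) (enum 'I_n) (fun U => f (i |: U) - f (U :\ i)) set0 <= 9 * t.
  have [_] := muI i; rewrite -/mu /=.
  set x := mean (2 / 3) _ _ _; set I := mean _ _ _ _ => xI.
  have [A [fA iA Ak]] := far i.
  have xt : t <= x.
    have f0A : f (A :\ i) = 1.
      rewrite -fA; congr f; apply/setP => y; rewrite !inE.
      by case: eqP => // ->; rewrite (negbTE iA).
    apply: (@le_trans _ _ ((2 / 3) ^+ count (mem A) (enum 'I_n))).
      rewrite ler_wiXn2l//; [lra|lra|].
      have -> : count (mem A) (enum 'I_n) = #|A| by rewrite enumT cardE -size_filter.
      by rewrite /k; lia.
    apply: (@mean_ge_pow _ _ _ _ (fun U => f (U :\ i)) A) => //; first lra.
    - by move=> S U SU; apply: fm; exact: setSD.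
    - by case: (f01 (set0 :\ i)) => ->.
    - by apply/subsetP => y _; rewrite !inE mem_enum.
  rewrite leNgt; apply/negP => It.
  have : t * (9 * t) < x * I.
    apply: (@lt_le_trans _ _ (t * I)); first by rewrite ltr_pM2l.
    by rewrite ler_wpM2r// (le_trans _ (ltW It))// mulr_ge0// ltW.
  lra.
have := @mean_poincare _ _ (1 / 3) (enum 'I_n) f set0 _ (enum_uniq _) fm f01.
rewrite -/mu.
have : \sum_(i <- enum 'I_n)
    mean (1 / 3) (enum 'I_n) (fun U => f (i |: U) - f (U :\ i)) set0 <= n%:R * (9 * t).
  apply: (@le_trans _ _ (\sum_(i <- enum 'I_n) 9 * t)); first by apply: ler_sum => i _; exact: Ile.
  by rewrite big_enum sumr_const card_ord [leRHS]mulr_natl.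
set s := \sum_(i <- _) _ => sle /(_ ltac:(lra)) pc.
have mu3 : mu <= 1 / 3 by have [] := muI (Ordinal (leq_trans (isT : (0 < 30)%N) n30)).
have nk : n%:R <= 2 * k%:R + 1 :> R.
  by rewrite -natrM natr1 ler_nat /k; lia.
have kt := @expr_two_third_le R k k15; rewrite -/t in kt.
have tt : t * t <= t * 1 by rewrite ler_wpM2l// ltW.
have k0 : 0 <= k%:R * t by rewrite mulr_ge0// ltW.
have nt : n%:R * t <= (2 * k%:R + 1) * t by rewrite ler_wpM2r// ltW.
have mu0 : 0 <= mu by lra.
(* Poincare gives 2/3 mu <= 2 n t <= (4k + 2) t, and mu > 1/3 - 2 t; together 1/3 < (6k + 5) t,
   against [kt]. *)
have : mu * (2 / 3) <= mu * (1 - mu) by rewrite ler_wpM2l//; lra.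
lra.
Qed.

(** * Sums over set families *)

Lemma card_sets (n : nat) : #|{: {set 'I_n}}| = (2 ^ n)%N.
Proof. by rewrite -cardsT -powersetT card_powerset cardsT card_ord. Qed.

Lemma sum_interval (R : comPzSemiRingType) (X : finType) (g : X -> R) (A D : {set X}) :
  [disjoint A & D] ->
  \sum_(F : {set X} | (A \subset F) && (F \subset A :|: D)) \prod_(S in F) g S
    = \prod_(S in A) g S * \prod_(S in D) (1 + g S).
Proof.
(* The product of [a S + b S] expands over all [F], with [a] on [F] and [b] off [F]; the zeros kill
   each [F] that leaves [A :|: D] or misses part of [A]. *)
move=> AD; pose a S := if S \in A :|: D then g S else 0.
pose b S : R := if S \in A then 0 else 1.
have -> : \prod_(S in A) g S * \prod_(S in D) (1 + g S) = \prod_S (a S + b S).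
  rewrite [in RHS](bigID (mem A)) /=; congr (_ * _).
    by apply: eq_bigr => S SA; rewrite /a /b inE SA addr0.
  rewrite [RHS](bigID (mem D)) /= [X in _ = _ * X]big1 ?mulr1; last first.
    by move=> S /andP[SA SD]; rewrite /a /b inE (negbTE SA) (negbTE SD) add0r.
  apply: eq_big => S.
    by case: (boolP (S \in D)) => SD; rewrite ?andbF ?andbT// (disjointFl AD SD).
  by move=> SD; rewrite /a /b inE SD orbT (disjointFl AD SD) addrC.
rewrite bigA_distr big_mkcond; apply: eq_bigr => F _.
case: ifP => [/andP[/subsetP AF /subsetP FAD]|/negbT].
  rewrite big_mkcond; apply: eq_bigr => S _; rewrite /a /b; case: ifP => SF.
    by rewrite FAD.
  by rewrite ifN//; apply: contraFN SF => /AF.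
rewrite negb_and => /orP[] /subsetPn[S]; rewrite ?inE => S1 S2.
  by rewrite (bigD1 S)//= /b (negbTE S2) S1 mul0r.
by rewrite (bigD1 S)//= /a inE S1 (negbTE S2) mul0r.
Qed.

Lemma sum_subsets (R : comPzSemiRingType) (X : finType) (g : X -> R) (D : {set X}) :
  \sum_(F : {set X} | F \subset D) \prod_(S in F) g S = \prod_(S in D) (1 + g S).
Proof.
have := @sum_interval R X g set0 D; rewrite big_set0 mul1r => <-.
  by apply: eq_bigl => F; rewrite sub0set set0U.
by rewrite -setI_eq0 set0I.
Qed.

Lemma sum_le_cover (R : numDomainType) (I X : finType) (P : pred X)
    (C : I -> pred X) (g : X -> R) :
  (forall F, 0 <= g F) -> (forall F, P F -> exists i, C i F) ->
  \sum_(F | P F) g F <= \sum_i \sum_(F | C i F) g F.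
Proof.
move=> g0 PC; rewrite (exchange_big_dep predT)//= [leLHS]big_mkcond.
apply: ler_sum => F _; case: ifP => [/PC[i iF]|_]; last exact: sumr_ge0.
by rewrite (bigD1 i)//= lerDl sumr_ge0.
Qed.

Lemma sum_ge_packing (R : numDomainType) (I X : finType) (P : pred X)
    (C : I -> pred X) (g : X -> R) :
  (forall F, 0 <= g F) -> (forall i F, C i F -> P F) ->
  (forall i j F, C i F -> C j F -> i = j) ->
  \sum_i \sum_(F | C i F) g F <= \sum_(F | P F) g F.
Proof.
move=> g0 CP Cinj; rewrite (exchange_big_dep P)//=; last by move=> i F _; exact: CP.
apply: ler_sum => F _; have [i iF|C0] := pickP (fun i => C i F).
  by rewrite (big_pred1 i)// => j; apply/idP/eqP => [jF|->//]; exact: Cinj jF iF.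
by rewrite big_pred0.
Qed.

Lemma sum_sub_le (R : numDomainType) (X : finType) (P Q : pred X) (g : X -> R) :
  (forall F, 0 <= g F) -> (forall F, P F -> Q F) ->
  \sum_(F | P F) g F <= \sum_(F | Q F) g F.
Proof.
move=> g0 PQ; rewrite [leLHS]big_mkcond [leRHS]big_mkcond; apply: ler_sum => F _.
by case: ifP => [/PQ ->//|_]; case: ifP.
Qed.

(** * Total weight of a star and reformulations of the two sums *)

Lemma sum_star (n : nat) (i : 'I_n) :
  (\sum_(S : {set 'I_n} | i \in S) 2 ^ (n - #|S|) = 3 ^ n.-1)%N.
Proof.
(* An element other than [i] contributes 1 if in [S] and 2 if not; [b i = 0] forces [i] into [S]. *)
pose a (j : 'I_n) := 1%N; pose b (j : 'I_n) := (if j == i then 0 else 2)%N.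
have -> : (3 ^ n.-1 = \prod_(j : 'I_n) (a j + b j))%N.
  rewrite (bigD1 i)//= /b eqxx mul1n (eq_bigr (fun=> 3)%N) => [|j /negbTE-> //].
  by rewrite prod_nat_const cardC1 card_ord.
rewrite bigA_distr big_mkcond; apply: eq_bigr => S _.
case: ifPn => iS; last by rewrite (bigD1 i)//= (negbTE iS) /b eqxx mul0n.
rewrite (eq_bigr (fun j => if j \in ~: S then 2 else 1)%N) => [|j _].
  by rewrite -big_mkcond prod_nat_const [in RHS]cardsCs setCK card_ord.
rewrite inE; case: ifP => //= jS; rewrite /b ifN//.
by apply: contraFN jS => /eqP->.
Qed.

Lemma natr_weight (R : pzSemiRingType) (n : nat) (S : {set 'I_n}) :
  1 + (weight S)%:R = 2 ^+ (2 ^ (n - #|S|)) :> R.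
Proof. by rewrite /weight -natrX nat1r -addn1 subnK// expn_gt0. Qed.

Lemma prod_star (R : comPzSemiRingType) (n : nat) (i : 'I_n) :
  \prod_(S : {set 'I_n} | i \in S) (1 + (weight S)%:R) = 2 ^+ (3 ^ n.-1) :> R.
Proof.
rewrite -(sum_star i) expr_sum; apply: eq_bigr => S _; exact: natr_weight.
Qed.

Lemma prod_star_D1 (R : numFieldType) (n : nat) (i : 'I_n) :
  \prod_(S : {set 'I_n} | (i \in S) && (S != [set i])) (1 + (weight S)%:R)
    = 2 ^+ (3 ^ n.-1) / 2 ^+ (2 ^ n.-1) :> R.
Proof.
rewrite -(prod_star _ i) [in RHS](bigD1 [set i]) ?set11//= natr_weight cards1 subn1.
by rewrite mulrC mulKf// expf_neq0// pnatr_eq0.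
Qed.

Lemma natr_Zcap (R : pzSemiRingType) (n : nat) :
  (Zcap n)%:R = \sum_(F : {set {set 'I_n}} | [&& F \subset nonempty_sets n, intersecting F
     & kernel F != set0]) \prod_(S in F) (weight S)%:R :> R.
Proof. by rewrite /Zcap natr_sum; apply: eq_bigr => F _; rewrite natr_prod. Qed.

Lemma natr_Rcap (R : pzSemiRingType) (n : nat) :
  (Rcap n)%:R = \sum_(F : {set {set 'I_n}} | [&& F \subset nonempty_sets n, intersecting F
     & kernel F == set0]) \prod_(S in F) (weight S)%:R :> R.
Proof. by rewrite /Rcap natr_sum; apply: eq_bigr => F _; rewrite natr_prod. Qed.

Lemma kernelP (n : nat) (F : {set {set 'I_n}}) i :
  reflect (forall S, S \in F -> i \in S) (i \in kernel F).
Proof. exact: bigcapP. Qed.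

Lemma intersectingP (n : nat) (F : {set {set 'I_n}}) :
  reflect (forall S U, S \in F -> U \in F -> exists2 x, x \in S & x \in U) (intersecting F).
Proof.
apply: (iffP forall_inP) => [h S U SF UF|h S SF].
  move/forall_inP: (h S SF) => /(_ U UF) /set0Pn[x]; rewrite inE => /andP[xS xU].
  by exists x.
apply/forall_inP => U UF; have [x xS xU] := h S U SF UF.
by apply/set0Pn; exists x; rewrite inE xS.
Qed.

Lemma prod_weight_ge0 (R : numDomainType) (n : nat) (F : {set {set 'I_n}}) :
  0 <= \prod_(S in F) (weight S)%:R :> R.
Proof. exact: prodr_ge0. Qed.

(** * Families with nonempty kernel *)

Lemma Zcap_le (R : realFieldType) (n : nat) :
  (Zcap n)%:R <= n%:R * 2 ^+ (3 ^ n.-1) :> R.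
Proof.
pose C (i : 'I_n) := [pred F : {set {set 'I_n}} | F \subset [set S : {set 'I_n} | i \in S]].
rewrite natr_Zcap; apply: (le_trans (@sum_le_cover _ 'I_n _ _ C _ _ _)).
- exact: prod_weight_ge0.
- move=> F /and3P[_ _ /set0Pn[i /kernelP iF]]; exists i; apply/subsetP => S /iF.
  by rewrite inE.
rewrite (eq_bigr (fun=> 2 ^+ (3 ^ n.-1))); first by rewrite sumr_const card_ord [leRHS]mulr_natl.
move=> i _; rewrite sum_subsets -(prod_star R i); apply: eq_bigl => S; exact: in_set.
Qed.

(** Only subfamilies of the star of [i] containing [[set i]] are counted: the singleton determines
    [i], so none is counted twice. It replaces the factor H = 2^(2^(n-1)) of the star by H - 1. *)
Lemma Zcap_ge (R : realFieldType) (n : nat) :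
  n%:R * 2 ^+ (3 ^ n.-1) * (1 - (2 ^+ (2 ^ n.-1))^-1) <= (Zcap n)%:R :> R.
Proof.
pose D i := [set S : {set 'I_n} | (i \in S) && (S != [set i])].
pose C i := [pred F : {set {set 'I_n}} |
  ([set [set i]] \subset F) && (F \subset [set [set i]] :|: D i)].
have CP i F : C i F -> forall S, S \in F -> i \in S.
  by move=> /andP[_ /subsetP h] S /h; rewrite !inE => /orP[/eqP->|/andP[]//]; rewrite set11.
have : \sum_i \sum_(F | C i F) \prod_(S in F) (weight S)%:R <= (Zcap n)%:R :> R.
  rewrite natr_Zcap; apply: sum_ge_packing => [F|i F iF|i j F iF jF].
  - exact: prod_weight_ge0.
  - have h := CP i F iF; apply/and3P; split.
    + by apply/subsetP => S /h iS; rewrite inE; apply/set0Pn; exists i.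
    + by apply/intersectingP => S U /h iS /h iU; exists i.
    + by apply/set0Pn; exists i; apply/kernelP.
  - case/andP: iF; rewrite sub1set => /(CP j F jF); by rewrite inE => /eqP.
apply: le_trans; rewrite (eq_bigr (fun=> 2 ^+ (3 ^ n.-1) * (1 - (2 ^+ (2 ^ n.-1))^-1))).
  by rewrite sumr_const card_ord -mulrA [leLHS]mulr_natl.
move=> i _; rewrite sum_interval; last by rewrite disjoints1 inE eqxx andbF.
rewrite big_set1 (eq_bigl (fun S : {set 'I_n} => (i \in S) && (S != [set i]))); last first.
  by move=> S; rewrite inE.
rewrite prod_star_D1; have := natr_weight R [set i]; rewrite cards1 subn1.
have : 2 ^+ (2 ^ n.-1) != 0 :> R by rewrite expf_neq0// pnatr_eq0.
move: (2 ^+ (2 ^ n.-1)) => H H0 wH; have -> : (weight [set i])%:R = H - 1 by rewrite -wH; ring.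
by field.
Qed.

(** * Product estimates and lower bound for families with empty kernel *)

Lemma prod_1B_ge (R : realDomainType) (X : finType) (P : pred X) (x : X -> R) :
  (forall S, P S -> 0 <= x S <= 1) ->
  1 - \sum_(S | P S) x S <= \prod_(S | P S) (1 - x S).
Proof.
move=> x01.
have [] : 1 - \sum_(S | P S) x S <= \prod_(S | P S) (1 - x S) /\
    (0 <= \prod_(S | P S) (1 - x S) <= 1) => //.
apply: (big_rec2 (fun s p => 1 - s <= p /\ (0 <= p <= 1)))
  => [|S s p /x01/andP[x0 x1] [IH /andP[p0 p1]]].
  by rewrite subr0 lexx ler01.
have h1 : 0 <= p * x S by rewrite mulr_ge0.
have h2 : 0 <= (1 - p) * x S by rewrite mulr_ge0// subr_ge0.
have h3 : 0 <= p * (1 - x S) by rewrite mulr_ge0// subr_ge0.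
by split; lra.
Qed.

Lemma expr_1D_le (R : realFieldType) (N : nat) (x : R) :
  0 <= x -> N%:R * x <= 1 / 2 -> (1 + x) ^+ N <= 1 + 2 * (N%:R * x).
Proof.
move=> x0 Nx.
(* That is, (1 + x)^M <= 1/(1 - M x) when M x < 1; then 1/(1 - e) <= 1 + 2e for 0 <= e <= 1/2. *)
have h M : (1 + x) ^+ M * (1 - M%:R * x) <= 1.
  elim: M => [|M IH]; first by rewrite expr0 mul0r subr0 mulr1.
  apply: le_trans IH; rewrite exprSr -mulrA ler_wpM2l ?exprn_ge0 ?addr_ge0//.
  have : 0 <= (M%:R + 1) * (x * x) by rewrite !mulr_ge0// addr_ge0.
  by rewrite -natr1; lra.
have := h N; move: (N%:R * x) Nx ((1 + x) ^+ N) (mulr_ge0 (ler0n R N) x0) => e e2 y e0 hy.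
rewrite leNgt; apply/negP => hlt.
have : (1 + 2 * e) * (1 - e) < y * (1 - e) by rewrite ltr_pM2r//; lra.
have : 0 <= e * (1 - 2 * e) by rewrite mulr_ge0//; lra.
lra.
Qed.

(** For each [i], take [[set~ i]], all pairs containing [i], and any larger sets containing [i]. The
    first two kinds leave no common element, and the pairs identify [i]. Forcing all pairs costs
    only the last factor. *)
Lemma Rcap_ge (R : realFieldType) (n : nat) : (4 <= n)%N ->
  n%:R * (3 * (2 ^+ (3 ^ n.-1) / 2 ^+ (2 ^ n.-1)) * (1 - 2 ^+ n / 2 ^+ (2 ^ (n - 2))))
    <= (Rcap n)%:R :> R.
Proof.
move=> n4.
pose P i := [set S : {set 'I_n} | (i \in S) && (#|S| == 2)].
pose A i := [set~ i] |: P i.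
pose D i := [set S : {set 'I_n} | (i \in S) && (2 < #|S|)%N].
pose C i := [pred F : {set {set 'I_n}} | (A i \subset F) && (F \subset A i :|: D i)].
have CP i F : C i F -> forall S, S \in F -> S = [set~ i] \/ (i \in S /\ (2 <= #|S|)%N).
  move=> /andP[_ /subsetP h] S /h; rewrite !inE.
  move=> /orP[/orP[/eqP->|/andP[? /eqP->]]|/andP[? /ltnW]].
  - by left.
  - by right.
  - by right.
have cardT i : #|[set~ i] : {set 'I_n}| = n.-1 by rewrite cardsC1 card_ord.
have pairF i k F : C i F -> k != i -> [set i; k] \in F.
  by move=> /andP[/subsetP h _] ki; apply: h; rewrite !inE eqxx cards2 (eq_sym i k) ki orbT.
have third (i j : 'I_n) : exists k, (k != i) && (k != j).
  apply/existsP; apply: contraLR n4; rewrite negb_exists => /forallP h.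
  have : [set: 'I_n] \subset [set i; j].
    by apply/subsetP => k _; have := h k; rewrite negb_and !negbK !inE.
  move=> /subset_leq_card; rewrite cardsT card_ord cards2; case: (i != j); lia.
have : \sum_i \sum_(F | C i F) \prod_(S in F) (weight S)%:R <= (Rcap n)%:R :> R.
  rewrite natr_Rcap; apply: sum_ge_packing => [F|i F iF|i j F iF jF].
  - exact: prod_weight_ge0.
  - have h := CP i F iF; apply/and3P; split.
    + apply/subsetP => S /h; rewrite inE => -[->|[iS _]]; apply/set0Pn; last by exists i.
      by have [k /andP[ki _]] := third i i; exists k; rewrite !inE.
    + have h2 (S : {set 'I_n}) : i \in S -> (2 <= #|S|)%N -> exists2 x, x \in S & x \in [set~ i].
        move=> iS S2; have : (0 < #|S :\ i|)%N by rewrite (cardsD1 i) iS in S2.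
        by rewrite card_gt0 => /set0Pn[x]; rewrite !inE => /andP[xi xS]; exists x; rewrite ?inE.
      apply/intersectingP => S U /h [->|[iS S2]] /h [->|[iU U2]].
      * by have [k /andP[ki _]] := third i i; exists k; rewrite !inE.
      * by have [x ? ?] := h2 U iU U2; exists x.
      * exact: h2.
      * by exists i.
    + apply/eqP/setP => k; rewrite inE; apply/negP => /kernelP kF.
      have TF : [set~ i] \in F by case/andP: iF => /subsetP + _; apply; rewrite !inE eqxx.
      have ki : k != i by have := kF _ TF; rewrite !inE.
      have [l /andP[li lk]] := third i k.
      by have := kF _ (pairF i l F iF li); rewrite !inE (negbTE ki) eq_sym (negbTE lk).
  (* A pair {i, k} with k outside {i, j} avoids [j], so in a family of [C j] it would be [[set~ j]],
     which has n - 1 > 2 elements. *)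
  - apply/eqP; apply: contraT => ij; have [k /andP[ki kj]] := third i j.
    case: (CP j F jF _ (pairF i k F iF ki)) => [e|[]].
      by have := cardT j; rewrite -e cards2; case: (i != k); lia.
    by rewrite !inE eq_sym (negbTE ij) eq_sym (negbTE kj).
apply: le_trans; rewrite [leLHS]mulr_natl -[X in _ *+ X]card_ord -sumr_const.
apply: ler_sum => i _; rewrite sum_interval; last first.
  rewrite disjoints_subset; apply/subsetP => S; rewrite !inE => /orP[/eqP->|/andP[iS /eqP->]].
    by rewrite !inE eqxx.
  by rewrite ltnn andbF.
rewrite big_setU1 /=; last by rewrite !inE eqxx.
have -> : (weight [set~ i])%:R = 3 :> R.
  by rewrite /weight cardT (_ : n - n.-1 = 1)%N//; lia.
(* The star without [[set i]] splits into pairs ([X]) and larger sets ([Y]); forcing the pairs turns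
   each factor 1 + w of [X] into w. *)
rewrite -(prod_star_D1 R i) (bigID (fun S : {set 'I_n} => #|S| == 2)) /=.
rewrite -!mulrA ler_wpM2l//.
set X := \prod_(S | _) _; set Y := \prod_(S | _) _;
set Z := \prod_(S in P i) _; set W := \prod_(S in D i) _.
have -> : Y = W.
  apply: eq_bigl => S; rewrite !inE; case: (boolP (i \in S)) => //= iS.
  have S0 : (0 < #|S|)%N by rewrite card_gt0; apply/set0Pn; exists i.
  have -> : (S != [set i]) = (#|S| != 1)%N.
    apply/idP/idP; apply: contraNN; last by move=> /eqP->; rewrite cards1.
    by move=> /cards1P[x xE]; move: iS; rewrite xE inE => /eqP->.
  by move: S0; case: #|S| => [|[|[|]]].
have W0 : 0 <= W by apply: prodr_ge0 => S _; rewrite addr_ge0.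
suff : X * (1 - 2 ^+ n / 2 ^+ (2 ^ (n - 2))) <= Z.
  by move=> h; rewrite mulrCA mulrC; apply: ler_wpM2r.
have XE : X = \prod_(S in P i) (1 + (weight S)%:R).
  apply: eq_bigl => S; rewrite !inE; case: (boolP (i \in S)) => //= iS.
  by case: (S =P [set i]) => // ->; rewrite cards1.
(* For a pair, w = (1 + w)(1 - y); the number of pairs is bounded crudely by 2^n. *)
pose y : R := (2 ^+ (2 ^ (n - 2)))^-1.
have H0 : 0 < 2 ^+ (2 ^ (n - 2)) :> R by rewrite exprn_gt0.
have -> : Z = X * \prod_(S in P i) (1 - y).
  rewrite XE -big_split; apply: eq_bigr => S; rewrite inE => /andP[_ /eqP S2] /=.
  have := natr_weight R S; rewrite S2 /y => wE; rewrite wE mulrBr mulr1 mulfV ?gt_eqF//.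
  by rewrite -wE addrAC subrr add0r.
have X0 : 0 <= X by rewrite XE; apply: prodr_ge0 => S _; rewrite addr_ge0.
apply: ler_wpM2l => //.
have y0 : 0 <= y by rewrite invr_ge0 ltW.
apply: le_trans (@prod_1B_ge _ _ (mem (P i)) (fun=> y) _); last first.
  by move=> S _; rewrite y0 invf_le1//= exprn_ege1// ler1n.
rewrite lerD2l lerN2 sumr_const -[leLHS]mulr_natl ler_wpM2r// -natrX ler_nat.
by rewrite -card_sets max_card.
Qed.

(** * Families far from every star *)

(** The up-set generated by [F] contains [F] and is still intersecting and far from all stars, so
    its measure is at most 1/3 - 2(2/3)^n; multiply by 3^n. *)
Lemma intersecting_exponent_le (n : nat) (F : {set {set 'I_n}}) :
  (30 <= n)%N -> intersecting F ->
  (forall i, exists A : {set 'I_n}, [/\ A \in F, i \notin A & (2 * #|A| <= n)%N]) ->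
  (\sum_(S in F) 2 ^ (n - #|S|) + 2 ^ n.+1 <= 3 ^ n.-1)%N.
Proof.
move=> n30 /intersectingP Fint far.
pose b (S : {set 'I_n}) := [exists A in F, A \subset S].
pose f S : rat := (b S)%:R.
have bF A : A \in F -> b A by move=> AF; apply/exists_inP; exists A.
have fm : monotone f.
  move=> S U SU; rewrite /f; case: (boolP (b S)) => // /exists_inP[A AF AS].
  suff -> : b U by []; apply/exists_inP; exists A => //; exact: subset_trans AS SU.
have f01 : zero_one f by move=> S; rewrite /f; case: (b S); [right|left].
have fc : sum_disjoint_le1 f.
  move=> S U SU; rewrite /f; case: (boolP (b S)) => [/exists_inP[A AF AS]|_]; last first.
    by rewrite add0r; case: (b U).
  case: (boolP (b U)) => [/exists_inP[V VF VU]|_]; last by rewrite addr0.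
  have [x xA xV] := Fint _ _ AF VF.
  by have := disjointFr SU (subsetP AS _ xA); rewrite (subsetP VU _ xV).
have := @intersecting_measure_le _ n f n30 fm f01 fc.
have ffar i : exists A : {set 'I_n}, [/\ f A = 1, i \notin A & (2 * #|A| <= n)%N].
  by have [A [AF iA Ak]] := far i; exists A; split=> //; rewrite /f bF.
move=> /(_ ffar); have n3 : 0 < 3 ^+ n :> rat by rewrite exprn_gt0.
have e23 : 3 ^+ n * (2 / 3) ^+ n = 2 ^+ n :> rat.
  by rewrite -exprMn; congr (_ ^+ _); field.
rewrite -(ler_pM2l n3) mean_enum_third mulrBr [3 ^+ n * (2 * _)]mulrCA e23.
have -> : 3 ^+ n * (1 / 3) = 3 ^+ n.-1 :> rat.
  by rewrite -[in LHS](prednK (leq_trans (isT : (0 < 30)%N) n30)) exprS; field.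
rewrite -(ler_nat rat) natrD natr_sum !natrX exprS => h.
rewrite -lerBrDr; apply: le_trans h; rewrite big_mkcond; apply: ler_sum => S _.
by case: ifP => [/bF bS|_]; rewrite /f ?bS ?mulr1 ?natrX// mulr_ge0// exprn_ge0.
Qed.

(** The cut at n/2 serves twice: its failure supplies a small member avoiding [i], and beyond it a
    member weighs far less than its complement. *)
Definition near_star (n : nat) (i : 'I_n) (F : {set {set 'I_n}}) :=
  [forall S in F, (i \notin S) ==> (n < 2 * #|S|)%N].

(** Each far family weighs at most Q/H^4 by [intersecting_exponent_le], and there are at most
    2^(2^n) = H^2 families. *)
Lemma sum_far_le (R : realFieldType) (n : nat) : (30 <= n)%N ->
  \sum_(F : {set {set 'I_n}} | intersecting F && [forall i, ~~ near_star i F])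
     \prod_(S in F) (weight S)%:R
    <= 2 ^+ (3 ^ n.-1) / 2 ^+ (2 ^ n.-1) / 2 ^+ (2 ^ n.-1) :> R.
Proof.
move=> n30; have n0 : (0 < n)%N by exact: leq_trans n30.
set Q : R := 2 ^+ (3 ^ n.-1); set H : R := 2 ^+ (2 ^ n.-1).
have H0 : 0 < H by rewrite exprn_gt0.
have HH : H * H = 2 ^+ (2 ^ n) by rewrite -exprD addnn -mul2n -expnS prednK.
have le1 (F : {set {set 'I_n}}) : intersecting F && [forall i, ~~ near_star i F] ->
    \prod_(S in F) (weight S)%:R <= Q / (H * H) / (H * H).
  move=> /andP[Fint /forallP far].
  have {}far i : exists A : {set 'I_n}, [/\ A \in F, i \notin A & (2 * #|A| <= n)%N].
    have := far i; rewrite negb_forall => /existsP[A]; rewrite !negb_imply -leqNgt => /and3P[? ? ?].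
    by exists A.
  have h := intersecting_exponent_le n30 Fint far.
  apply: (@le_trans _ _ (\prod_(S in F) 2 ^+ (2 ^ (n - #|S|)))).
    by apply: ler_prod => S _; rewrite ler0n -natr_weight lerDr ler01.
  rewrite -expr_sum !ler_pdivlMr ?mulr_gt0// HH -!exprD ler_weXn2l ?ler1n//.
  by move: h; rewrite expnS; lia.
apply: le_trans (ler_sum _ le1) _; rewrite sumr_const.
have QH : 0 <= Q / (H * H) / (H * H) by rewrite !divr_ge0// ?mulr_ge0 ?ltW// exprn_gt0.
rewrite -[leLHS]mulr_natl; set m := (#|_|%:R : R).
have hm : m <= H * H.
  rewrite HH -natrX ler_nat; apply: leq_trans (max_card _) _.
  by rewrite -cardsT -powersetT card_powerset cardsT card_sets.
apply: le_trans (ler_wpM2r QH hm) _.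
suff -> : H * H * (Q / (H * H) / (H * H)) = Q / H / H by [].
by field; rewrite gt_eqF.
Qed.

(** * Families near a star and upper bound for empty kernel *)

(** Group the families by the set [G] of members avoiding [i], nonempty as [i] is not in the kernel.
    Relative to [QH], each [A] in [G] costs a factor [r A], so summing over [G] gives the product of
    all [1 + r A], minus 1. The factor of [[set~ i]] is 4; the others together are at most 1 +
    2e. *)
Lemma sum_near_star_le (R : realFieldType) (n : nat) (i : 'I_n) : (4 <= n)%N ->
  let e : R := 2 ^+ n / 2 ^+ (2 ^ n./2) in e <= 1 / 2 ->
  \sum_(F : {set {set 'I_n}} | [&& intersecting F, kernel F == set0 & near_star i F])
     \prod_(S in F) (weight S)%:R
    <= 2 ^+ (3 ^ n.-1) / 2 ^+ (2 ^ n.-1) * (4 * (1 + 2 * e) - 1).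
Proof.
move=> n4 e e2.
set QH : R := 2 ^+ (3 ^ n.-1) / 2 ^+ (2 ^ n.-1).
have QH0 : 0 <= QH by rewrite divr_ge0 ?exprn_ge0.
pose Big := [set A : {set 'I_n} | (i \notin A) && (n < 2 * #|A|)%N].
pose star := [set B : {set 'I_n} | i \in B].
pose w (A : {set 'I_n}) : R := (weight A)%:R.
(* The value at [[set i]] is 1 because [QH] already omits the factor of this set, which any member
   of [G] excludes. *)
pose u (B : {set 'I_n}) := if B == [set i] then 1 else 1 + w B.
have u0 B : 0 < u B by rewrite /u; case: ifP => // _; rewrite ltr_pwDl.
pose r A := w A / u (~: A).
have inner (G : {set {set 'I_n}}) : G \subset Big -> G != set0 ->
    \sum_(F | [&& intersecting F, kernel F == set0 & near_star i F] && (F :\: star == G))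
      \prod_(S in F) w S <= QH * \prod_(A in G) r A.
  move=> /subsetP GB /set0Pn[A0 A0G].
  (* Members containing [i] lie in [D]: [[set i]] misses [A0], and the complement of a member of [G]
     misses that member. *)
  pose D := [set B : {set 'I_n} | [&& i \in B, B != [set i] & ~: B \notin G]].
  apply: (@le_trans _ _ (
    \sum_(F : {set {set 'I_n}} | (G \subset F) && (F \subset G :|: D)) \prod_(S in F) w S)).
    apply: sum_sub_le => [F|F]; first exact: prod_weight_ge0.
    move=> /andP[/and3P[/intersectingP Fi _ _] /eqP FG].
    have GF : G \subset F by rewrite -FG subsetDl.
    rewrite GF /=; apply/subsetP => S SF; rewrite !inE.
    case: (boolP (i \in S)) => iS; last by rewrite -FG !inE iS SF.
    rewrite /=; apply/orP; right; apply/andP; split.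
      apply/eqP => SE; have [x] := Fi _ _ SF (subsetP GF _ A0G).
      by rewrite SE inE => /eqP->; have := GB _ A0G; rewrite inE => /andP[/negP].
    apply/negP => CS; have [x xS] := Fi _ _ SF (subsetP GF _ CS).
    by rewrite inE xS.
  rewrite sum_interval; last first.
    rewrite disjoints_subset; apply/subsetP => S /GB; rewrite !inE => /andP[/negbTE-> //].
  have uG0 : \prod_(A in G) u (~: A) != 0 by apply/prodf_neq0 => A _; rewrite gt_eqF.
  rewrite [X in _ <= _ * X]big_split prodfV /= mulrCA ler_wpM2l ?prod_weight_ge0//.
  rewrite ler_pdivlMr ?lt_def ?uG0 ?prodr_ge0//; last by move=> A _; exact: ltW.
  rewrite /QH -(prod_star_D1 R i).
  have toU (p : pred {set 'I_n}) :
      \prod_(B : {set 'I_n} | [&& i \in B, B != [set i] & p B]) (1 + w B) =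
      \prod_(B : {set 'I_n} | (i \in B) && p B) u B.
    rewrite big_mkcond [RHS]big_mkcond; apply: eq_bigr => B _; rewrite /u.
    by case: eqP => _ /=; rewrite ?andbF ?if_same.
  have -> : \prod_(B : {set 'I_n} | (i \in B) && (B != [set i])) (1 + (weight B)%:R) =
      \prod_(B : {set 'I_n} | i \in B) u B.
    have := toU predT.
    rewrite (eq_bigl (fun B : {set 'I_n} => (i \in B) && (B != [set i]))) => [->|B].
      by apply: eq_bigl => B; rewrite andbT.
    by rewrite andbT.
  rewrite [leRHS](bigID (fun B : {set 'I_n} => ~: B \in G)) /=.
  have /= <- := toU (fun B => ~: B \notin G).
  have -> : \prod_(B : {set 'I_n} | (i \in B) && (~: B \in G)) u B = \prod_(A in G) u (~: A).
    rewrite (reindex_inj (inv_inj (@setCK _))); apply: eq_bigl => A.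
    rewrite setCK inE; apply/andP/idP => [[]//|AG]; split=> //.
    by have := GB _ AG; rewrite inE => /andP[].
  rewrite le_eqVlt; apply/orP; left; apply/eqP; rewrite mulrC; congr (_ * _).
  by apply: eq_bigl => B; rewrite inE.
rewrite (partition_big (fun F => F :\: star)
  (fun G => (G \subset Big) && (G != set0))) /=; last first.
  move=> F /and3P[_ /eqP Fk /forall_inP Fn]; apply/andP; split.
    apply/subsetP => S; rewrite !inE => /andP[iS SF]; rewrite iS /=.
    by have := Fn S SF; rewrite iS.
  apply/eqP => F0; have : i \in kernel F.
    apply/kernelP => S SF; apply: contraT => iS.
    have : S \in F :\: star by rewrite !inE iS.
    by rewrite F0 inE.
  by rewrite Fk inE.
apply: le_trans (ler_sum _ (fun G hG => inner G (proj1 (andP hG)) (proj2 (andP hG)))) _.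
rewrite -mulr_sumr ler_wpM2l//.
have -> : \sum_(G : {set {set 'I_n}} | (G \subset Big) && (G != set0)) \prod_(A in G) r A
    = \prod_(A in Big) (1 + r A) - 1.
  by rewrite -sum_subsets [in RHS](bigD1 set0) ?sub0set//= big_set0 [RHS]addrAC subrr add0r.
rewrite lerD2r.
have cardT : #|[set~ i] : {set 'I_n}| = n.-1 by rewrite cardsC1 card_ord.
rewrite (bigD1 [set~ i]) /=; last by rewrite !inE eqxx cardT; lia.
have -> : r [set~ i] = 3.
  by rewrite /r /u setCK eqxx divr1 /w /weight cardT (_ : n - n.-1 = 1)%N//; lia.
have -> : 1 + 3 = 4 :> R by ring.
rewrite ler_wpM2l//.
pose eps : R := (2 ^+ (2 ^ n./2))^-1.
have eps0 : 0 <= eps by rewrite invr_ge0 exprn_ge0.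
have eE : (2 ^ n)%:R * eps = e by rewrite natrX.
rewrite -eE; apply: le_trans (expr_1D_le eps0 _); last by rewrite eE.
rewrite -card_sets -prodr_const big_mkcond; apply: ler_prod => A _.
case: ifP => [/andP[]|_]; last by rewrite ler01 lerDl.
rewrite inE => /andP[iA nA] AT.
have w0 : 0 <= w A by rewrite ler0n.
have r0 : 0 <= r A by rewrite divr_ge0// ltW.
rewrite addr_ge0//= lerD2l ler_pdivrMr//.
have -> : u (~: A) = 2 ^+ (2 ^ #|A|).
  rewrite /u; case: eqP => [CA|_]; first by rewrite -CA setCK eqxx in AT.
  by rewrite natr_weight cardsCs setCK card_ord subKn// -[X in (_ <= X)%N]card_ord max_card.
rewrite mulrC ler_pdivlMr ?exprn_gt0//.
(* As 2|A| > n, both n - |A| and n/2 rounded down are at most |A| - 1, so their powers of two sum to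
   at most 2^|A|. *)
apply: (@le_trans _ _ (2 ^+ (2 ^ (n - #|A|)) * 2 ^+ (2 ^ n./2))).
  by rewrite ler_wpM2r ?exprn_ge0// -natr_weight lerDr ler01.
rewrite -exprD ler_weXn2l ?ler1n//.
move: (nA : (n < 2 * #|A|)%N); move: #|A| => k nk.
have k0 : (0 < k)%N by lia.
rewrite -[X in (_ <= 2 ^ X)%N](prednK k0) expnS mul2n -addnn.
by apply: leq_add; rewrite leq_exp2l//; lia.
Qed.

Lemma Rcap_le (R : realFieldType) (n : nat) : (30 <= n)%N ->
  let e : R := 2 ^+ n / 2 ^+ (2 ^ n./2) in e <= 1 / 2 ->
  (Rcap n)%:R <= n%:R * (2 ^+ (3 ^ n.-1) / 2 ^+ (2 ^ n.-1) * (4 * (1 + 2 * e) - 1))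
     + 2 ^+ (3 ^ n.-1) / 2 ^+ (2 ^ n.-1) / 2 ^+ (2 ^ n.-1) :> R.
Proof.
move=> n30 e e2; rewrite natr_Rcap (bigID (fun F => [exists i, near_star i F])) /=.
apply: lerD; last first.
  apply: le_trans (sum_far_le R n30); apply: sum_sub_le => F; first exact: prod_weight_ge0.
  by rewrite negb_exists => /andP[/and3P[_ -> _]].
pose C i := [pred F : {set {set 'I_n}} | [&& intersecting F, kernel F == set0 & near_star i F]].
apply: (le_trans (@sum_le_cover _ 'I_n _ _ C _ _ _)).
- exact: prod_weight_ge0.
- by move=> F /andP[/and3P[_ FI Fk] /existsP[i Fi]]; exists i; apply/and3P.
rewrite [leRHS]mulr_natl -[X in _ *+ X]card_ord -sumr_const; apply: ler_sum => i _.
by apply: sum_near_star_le => //; lia.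
Qed.

(* Asymptotics of the ratio *)
From mathcomp Require Import all_classical all_reals all_analysis.

Import numFieldNormedType.Exports.

Local Open Scope classical_set_scope.
Local Open Scope ring_scope.

Lemma leq_expn2_half (n : nat) : (8 <= n)%N -> (n + n./2 <= 2 ^ n./2)%N.
Proof.
move=> n8; have : (4 <= n./2)%N by lia.
have : (n <= (2 * n./2).+1)%N by lia.
move: n./2 => k nk k4.
have h j : (3 * (4 + j) + 1 <= 2 ^ (4 + j))%N.
  by elim: j => [//|j IH]; rewrite addnS expnS; move: (2 ^ (4 + j))%N IH; lia.
by have := h (k - 4)%N; rewrite subnKC//; lia.
Qed.

Lemma error_le_harmonic (R : realFieldType) (n : nat) : (8 <= n)%N ->
  2 ^+ n / 2 ^+ (2 ^ n./2) <= 2 * n.+1%:R^-1 :> R.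
Proof.
move=> /leq_expn2_half nk.
rewrite ler_pdivrMr ?exprn_gt0// mulrAC ler_pdivlMr//.
apply: (@le_trans _ _ (2 ^+ n * (2 * 2 ^+ n./2))).
  rewrite ler_wpM2l ?exprn_ge0// -natrX -natrM ler_nat.
  have : (n./2 < 2 ^ n./2)%N by exact: ltn_expl.
  lia.
by rewrite mulrCA ler_wpM2l// -exprD ler_weXn2l// ler1n.
Qed.

Lemma Zcap_ratio_bounds (R : realFieldType) (n : nat) (e : R) : (30 <= n)%N ->
  e = 2 ^+ n / 2 ^+ (2 ^ n./2) ->
  1 - e <= (Zcap n)%:R / (n%:R * 2 ^+ (3 ^ n.-1)) <= (1 : R).
Proof.
move=> n30 eE.
have n0 : 0 < n%:R :> R by rewrite ltr0n; lia.
have nQ0 : 0 < n%:R * 2 ^+ (3 ^ n.-1) :> R by rewrite mulr_gt0// exprn_gt0.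
rewrite ler_pdivlMr// ler_pdivrMr// mul1r Zcap_le andbT mulrC.
apply: le_trans (Zcap_ge R n); rewrite ler_wpM2l ?(ltW nQ0)// lerD2l lerN2.
rewrite eE -[leLHS]mul1r ler_pM ?invr_ge0 ?exprn_ge0 ?exprn_ege1 ?ler1n//.
by rewrite lef_pV2 ?posrE ?exprn_gt0// ler_weXn2l ?ler1n// leq_exp2l//; lia.
Qed.

Lemma Rcap_ratio_bounds (R : realFieldType) (n : nat) (e : R) : (30 <= n)%N ->
  e = 2 ^+ n / 2 ^+ (2 ^ n./2) ->
  3 * (1 - e) <= (Rcap n)%:R * 2 ^+ (2 ^ n.-1) / (n%:R * 2 ^+ (3 ^ n.-1)) <= 3 + 9 * e.
Proof.
move=> n30 eE.
have n1 : 1 <= n%:R :> R by rewrite ler1n; lia.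
have n0 : 0 < n%:R :> R by lra.
have Q0 : 0 < 2 ^+ (3 ^ n.-1) :> R by rewrite exprn_gt0.
have H0 : 0 < 2 ^+ (2 ^ n.-1) :> R by rewrite exprn_gt0.
have lepow (m : nat) : (n./2 <= m)%N -> (2 ^+ (2 ^ m))^-1 <= (2 ^+ (2 ^ n./2))^-1 :> R.
  by move=> hm; rewrite lef_pV2 ?posrE ?exprn_gt0// ler_weXn2l ?ler1n// leq_exp2l.
have He : (2 ^+ (2 ^ n.-1))^-1 <= e.
  rewrite eE -[leLHS]mul1r ler_pM ?invr_ge0 ?exprn_ge0 ?exprn_ege1 ?ler1n// lepow//; lia.
have e2 : e <= 1 / 2.
  rewrite eE; apply: le_trans (error_le_harmonic _ _) _; first lia.
  have : 4 <= n.+1%:R :> R by rewrite ler_nat; lia.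
  by rewrite ler_pdivrMr//; lra.
have e0 : 0 <= e by rewrite eE divr_ge0 ?exprn_ge0.
have e' : 2 ^+ n / 2 ^+ (2 ^ (n - 2)) <= e.
  by rewrite eE ler_wpM2l ?exprn_ge0// lepow//; lia.
apply/andP; split.
  rewrite ler_pdivlMr ?mulr_gt0// -ler_pdivrMr//.
  apply: le_trans (Rcap_ge R _); last lia.
  set Q := 2 ^+ (3 ^ _) in Q0 *; set H := 2 ^+ (2 ^ n.-1) in H0 *.
  have -> : 3 * (1 - e) * (n%:R * Q) / H =
    n%:R * (3 * (Q / H) * (1 - e)) by field; rewrite gt_eqF.
  by rewrite ler_wpM2l ?(ltW n0)// ler_wpM2l ?mulr_ge0 ?invr_ge0 ?(ltW Q0) ?(ltW H0)// lerD2l lerN2.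
rewrite ler_pdivrMr ?mulr_gt0// -ler_pdivlMr//.
apply: le_trans (Rcap_le n30 _) _; rewrite -eE//.
set Q := 2 ^+ (3 ^ _) in Q0 *; set H := 2 ^+ (2 ^ n.-1) in H0 He *.
(* Near families give 4(1 + 2e) - 1 = 3 + 8e; far ones add at most one more e, since 1/H <= e <= n
   e. *)
have -> : (3 + 9 * e) * (n%:R * Q) / H =
    n%:R * (Q / H * (4 * (1 + 2 * e) - 1)) + (Q / H) * (n%:R * e).
  by field; rewrite gt_eqF.
rewrite lerD2l ler_wpM2l ?divr_ge0 ?(ltW Q0) ?(ltW H0)//.
by rewrite -[leLHS]mul1r ler_pM ?invr_ge0 ?(ltW H0).
Qed.

Theorem corollary5p9 (R : realType) :
  (fun n : nat => log2 ((Zcap n)%:R / (Rcap n)%:R : R)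
                  - (2 ^+ n.-1 - 2 + log2 (4 / 3))) @ \oo --> (0 : R).
Proof.
pose e (n : nat) : R := 2 ^+ n / 2 ^+ (2 ^ n./2).
(* With Q = 2^(3^(n-1)), the sums are divided by n Q and n Q/H, so the limits are 1 and 3. *)
pose a (n : nat) : R := (Zcap n)%:R / (n%:R * 2 ^+ (3 ^ n.-1)).
pose b (n : nat) : R := (Rcap n)%:R * 2 ^+ (2 ^ n.-1) / (n%:R * 2 ^+ (3 ^ n.-1)).
have e0 : e @ \oo --> (0 : R).
  apply: (@squeeze_cvgr _ _ _ _ (fun=> 0) (fun n => 2 * harmonic n)).
  - near=> n; rewrite divr_ge0 ?exprn_ge0//= error_le_harmonic//.
    by near: n; exact: nbhs_infty_ge.
  - exact: cvg_cst.
  - by rewrite -[X in _ --> X](mulr0 2); apply: cvgM; [exact: cvg_cst|exact: cvg_harmonic].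
have a1 : a @ \oo --> (1 : R).
  apply: (@squeeze_cvgr _ _ _ _ (fun n => 1 - e n) (fun=> 1)).
  - near=> n; apply: Zcap_ratio_bounds => //; near: n; exact: nbhs_infty_ge.
  - by rewrite -[X in _ --> X](subr0 1); apply: cvgB => //; exact: cvg_cst.
  - exact: cvg_cst.
have b3 : b @ \oo --> (3 : R).
  apply: (@squeeze_cvgr _ _ _ _ (fun n => 3 * (1 - e n)) (fun n => 3 + 9 * e n)).
  - near=> n; apply: Rcap_ratio_bounds => //; near: n; exact: nbhs_infty_ge.
  - have : (fun n => 3 * (1 - e n)) @ \oo --> 3 * (1 - 0 : R); last by rewrite subr0 mulr1.
    by apply: cvgM; [exact: cvg_cst|apply: cvgB => //; exact: cvg_cst].
  - have : (fun n => 3 + 9 * e n) @ \oo --> 3 + 9 * (0 : R); last by rewrite mulr0 addr0.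
    by apply: cvgD; [exact: cvg_cst|apply: cvgM => //; exact: cvg_cst].
have c1 : (fun n => 3 * (a n / b n)) @ \oo --> (1 : R).
  have : (fun n => 3 * (a n / b n)) @ \oo --> 3 * (1 / 3 : R);
    last by rewrite div1r mulfV ?pnatr_eq0.
  apply: cvgM; first exact: cvg_cst.
  by apply: cvgM => //; apply: (@cvgV _ _ _ _ b) => //; rewrite pnatr_eq0.
have ln2_neq0 : ln 2 != 0 :> R by rewrite gt_eqF// ln_gt0// ltr1n.
have : (fun n => log2 (3 * (a n / b n))) @ \oo --> (0 : R).
  have : (fun n => log2 (3 * (a n / b n))) @ \oo --> (ln 1 / ln 2 : R); last by rewrite ln1 mul0r.
  apply: cvgM; last exact: cvg_cst.
  by apply: continuous_cvg c1; exact: continuous_ln.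
apply: cvg_trans; apply: near_eq_cvg; near=> n.
have n30 : (30 <= n)%N by near: n; exact: nbhs_infty_ge.
have a0 : 0 < a n by near: n; exact: (cvgr_gt _ a1).
have b0 : 0 < b n by near: n; exact: (cvgr_gt _ b3).
have n0 : 0 < n%:R :> R by rewrite ltr0n; lia.
have Q0 : 0 < n%:R * 2 ^+ (3 ^ n.-1) :> R by rewrite mulr_gt0// exprn_gt0.
have H0 : 0 < 2 ^+ (2 ^ n.-1) :> R by rewrite exprn_gt0.
have Z0 : 0 < (Zcap n)%:R :> R by move: a0; rewrite /a pmulr_lgt0// invr_gt0.
have R0 : 0 < (Rcap n)%:R :> R by move: b0; rewrite /b pmulr_lgt0 ?invr_gt0// pmulr_lgt0.
(* The ratio of the sums is H a/b with log2 H = 2^(n-1), and log2(4/3) - 2 = -log2 3, so the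
   deviation is exactly log2(3a/b). *)
have -> : 3 * (a n / b n) = (Zcap n)%:R / (Rcap n)%:R * (3 / 2 ^+ (2 ^ n.-1)).
  by rewrite /a /b; field; rewrite !gt_eqF.
rewrite /log2 lnM ?posrE ?divr_gt0// (ln_div (x := 3)) ?posrE// lnXn// (ln_div (x := 4)) ?posrE//.
have -> : 4 = 2 ^+ 2 :> R by rewrite expr2; ring.
rewrite lnXn// -[ln 2 *+ 2]mulr_natl -[ln 2 *+ (2 ^ _)]mulr_natl natrX.
by field.
Unshelve. all: by end_near.
Qed.
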